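(* (i) The timelike general rotational surface of first type $\mathcal{M}_1$ has parallel normalized mean curvature vector field if and only if, up to parametrization, the meridian curve is determined by $c: x(u)=(f(u),0,0,u)$, where $$f(u)=\pm\sqrt{u^2+C^2};\quad C=const\neq0.$$ (ii) The timelike general rotational surface of second type $\mathcal{M}_2$ has parallel normalized mean curvature vector field if and only if, up to parametrization, the meridian curve is determined by $c: x(u)=(f(u),0,u,0)$, where $$f(u)=\pm\sqrt{C^2-u^2};\quad u\in(-C,C);\quad C=const\neq0.$$
   Context: $\mathbb{R}^4_1$ is the four-dimensional Minkowski space, i.e. $\mathbb{R}^4$ with the flat metric $\langle\cdot,\cdot\rangle = dx_1^2+dx_2^2+dx_3^2-dx_4^2$. A surface in it is timelike if the induced metric has index 1. Let $J\subset\mathbb{R}$ be an interval, $f,g$ smooth functions on $J$, $\alpha,\beta$ positive constants, $u\in J$, $v\in[0,2\pi)$; a prime denotes $d/du$. Timelike general rotational surface of first type: $$\mathcal{M}_1: z(u,v)=(f(u)\cos\alpha v,\ f(u)\sin\alpha v,\ g(u)\sinh\beta v,\ g(u)\cosh\beta v),$$ where $f'^2-g'^2<0$ and $\alpha^2f^2+\beta^2g^2>0$. Its meridian curve is $c: x(u)=(f(u),0,0,g(u))$. Timelike general rotational surface of second type: $$\mathcal{M}_2: z(u,v)=(f(u)\cos\alpha v,\ f(u)\sin\alpha v,\ g(u)\cosh\beta v,\ g(u)\sinh\beta v),$$ where $\alpha^2f^2-\beta^2g^2<0$ and $f'^2+g'^2>0$. Its meridian curve is $c: x(u)=(f(u),0,g(u),0)$.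 Standing assumption: all surfaces are free of inflection points. This means that, for an orthonormal normal frame $\{n_1,n_2\}$ and $c_{11}^k=\langle z_{uu},n_k\rangle$, $c_{12}^k=\langle z_{uv},n_k\rangle$, $c_{22}^k=\langle z_{vv},n_k\rangle$ ($k=1,2$), the three determinants $\Delta_1=c_{11}^1c_{12}^2-c_{12}^1c_{11}^2$, $\Delta_2=c_{11}^1c_{22}^2-c_{22}^1c_{11}^2$, $\Delta_3=c_{12}^1c_{22}^2-c_{22}^1c_{12}^2$ do not all vanish at any point. With $\widetilde\nabla$ the Levi-Civita connection of $\mathbb{R}^4_1$: $\sigma(x,y)$ is the normal component of $\widetilde\nabla_xy$ for $x,y$ tangent; the normal connection $D_x\xi$ is the normal component of $\widetilde\nabla_x\xi$ for $x$ tangent and $\xi$ normal; the mean curvature vector field is $H=\tfrac12\operatorname{tr}\sigma$ (trace with respect to the induced metric). A normal vector field $\xi$ is parallel if $D\xi=0$. A surface has parallel normalized mean curvature vector field if $H$ is non-zero and there exists a unit vector field in the direction of $H$ which is parallel in the normal bundle.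
   Formalization: In (ii) the stated equivalence is for meridians with f nowhere zero; in general, parallelism is equivalent to every arc with f ≠ 0 being the stated curve with one common C, since (C sin t, 0, C cos t, 0) near t = 0 qualifies but leaves u in (-C, C). *)

(* Defs.v *)
From Stdlib Require Import Reals.
From Coquelicot Require Import Coquelicot.
Open Scope R_scope.

(** * Minkowski space R^4_1

    Vectors are nested pairs, so that addition [plus] and scaling [scal] are
    those of Coquelicot's product modules. *)

Notation R4 := (R * R * R * R)%type.

Definition x1 (w : R4) : R := fst (fst (fst w)).
Definition x2 (w : R4) : R := snd (fst (fst w)).
Definition x3 (w : R4) : R := snd (fst w).
Definition x4 (w : R4) : R := snd w.

Definition mink (a b : R4) : R :=
  x1 a * x1 b + x2 a * x2 b + x3 a * x3 b - x4 a * x4 b.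

(** * Intervals and smoothness *)

(** Any kind of interval (open, closed, half-open, bounded or not) that is not
    empty and not reduced to a point. *)
Definition interval (J : R -> Prop) : Prop :=
  (exists a b, a < b /\ J a /\ J b) /\
  (forall a b c, J a -> J b -> a <= c <= b -> J c).

(** C^oo on a neighbourhood of [J]; at an endpoint of [J] belonging to [J] this
    is the usual convention that the function extends smoothly. *)
Definition smooth_on (J : R -> Prop) (h : R -> R) : Prop :=
  forall u, J u -> locally u (fun x => forall n, ex_derive_n h n x).

(** The parameter domain u in J, v in [0, 2 pi). *)
Definition dom (J : R -> Prop) (u v : R) : Prop := J u /\ 0 <= v < 2 * PI.

Definition smooth2 (F : R -> R -> R) (u v : R) : Prop :=
  locally_2d (fun x y => forall n, ex_diff_n F n x y) u v.

Definition smooth_field (J : R -> Prop) (w : R -> R -> R4) : Prop :=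
  forall u v, dom J u v ->
    smooth2 (fun x y => x1 (w x y)) u v /\ smooth2 (fun x y => x2 (w x y)) u v /\
    smooth2 (fun x y => x3 (w x y)) u v /\ smooth2 (fun x y => x4 (w x y)) u v.

Definition d_u (w : R -> R -> R4) (u v : R) : R4 :=
  (Derive (fun t => x1 (w t v)) u, Derive (fun t => x2 (w t v)) u,
   Derive (fun t => x3 (w t v)) u, Derive (fun t => x4 (w t v)) u).

Definition d_v (w : R -> R -> R4) (u v : R) : R4 :=
  (Derive (fun t => x1 (w u t)) v, Derive (fun t => x2 (w u t)) v,
   Derive (fun t => x3 (w u t)) v, Derive (fun t => x4 (w u t)) v).

(** * Geometry of a parametrized surface z = z(u,v) in R^4_1

    The Levi-Civita connection of R^4_1 is componentwise differentiation. *)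

Definition fE (z : R -> R -> R4) (u v : R) : R := mink (d_u z u v) (d_u z u v).
Definition fF (z : R -> R -> R4) (u v : R) : R := mink (d_u z u v) (d_v z u v).
Definition fG (z : R -> R -> R4) (u v : R) : R := mink (d_v z u v) (d_v z u v).

Definition normal_at (z : R -> R -> R4) (u v : R) (w : R4) : Prop :=
  mink w (d_u z u v) = 0 /\ mink w (d_v z u v) = 0.

(** Tangential component: the coefficients of z_u and z_v solve the linear
    system given by the Gram matrix (E, F; F, G), invertible since the induced
    metric is nondegenerate. *)
Definition tangential_part (z : R -> R -> R4) (u v : R) (w : R4) : R4 :=
  let E := fE z u v in let F := fF z u v in let G := fG z u v in
  let p := mink w (d_u z u v) in let q := mink w (d_v z u v) in
  plus (scal ((G * p - F * q) / (E * G - F ^ 2)) (d_u z u v))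
       (scal ((E * q - F * p) / (E * G - F ^ 2)) (d_v z u v)).

Definition normal_part (z : R -> R -> R4) (u v : R) (w : R4) : R4 :=
  minus w (tangential_part z u v w).

(** sigma(z_u, z_u), sigma(z_u, z_v), sigma(z_v, z_v) *)
Definition sigma_uu z (u v : R) : R4 := normal_part z u v (d_u (d_u z) u v).
Definition sigma_uv z (u v : R) : R4 := normal_part z u v (d_v (d_u z) u v).
Definition sigma_vv z (u v : R) : R4 := normal_part z u v (d_v (d_v z) u v).

(** H = (1/2) g^{ij} sigma_{ij}, with (g^{ij}) the inverse of (E, F; F, G). *)
Definition mean_curvature (z : R -> R -> R4) (u v : R) : R4 :=
  let E := fE z u v in let F := fF z u v in let G := fG z u v in
  scal (/ 2 * / (E * G - F ^ 2))
    (plus (plus (scal G (sigma_uu z u v)) (scal (- (2 * F)) (sigma_uv z u v)))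
          (scal E (sigma_vv z u v))).

(** D_x xi at (u,v) for the tangent vector x = a z_u + b z_v. *)
Definition normal_connection (z xi : R -> R -> R4) (a b u v : R) : R4 :=
  normal_part z u v (plus (scal a (d_u xi u v)) (scal b (d_v xi u v))).

Definition parallel_normal_field (J : R -> Prop) (z xi : R -> R -> R4) : Prop :=
  smooth_field J xi /\
  (forall u v, dom J u v -> normal_at z u v (xi u v)) /\
  (forall u v, dom J u v ->
     forall a b, normal_connection z xi a b u v = zero).

(** The normal planes of a timelike surface are spacelike, hence a unit normal
    vector has square +1. *)
Definition parallel_normalized_mean_curvature
    (J : R -> Prop) (z : R -> R -> R4) : Prop :=
  (forall u v, dom J u v -> mean_curvature z u v <> zero) /\
  exists xi : R -> R -> R4,
    (forall u v, dom J u v ->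
       mink (xi u v) (xi u v) = 1 /\
       exists l, 0 < l /\ xi u v = scal l (mean_curvature z u v)) /\
    parallel_normal_field J z xi.

Definition orthonormal_normal_frame
    (z : R -> R -> R4) (u v : R) (n1 n2 : R4) : Prop :=
  normal_at z u v n1 /\ normal_at z u v n2 /\
  mink n1 n1 = 1 /\ mink n2 n2 = 1 /\ mink n1 n2 = 0.

(** The simultaneous vanishing of the three determinants does not depend on
    the choice of the orthonormal normal frame. *)
Definition no_inflection_points (J : R -> Prop) (z : R -> R -> R4) : Prop :=
  forall u v, dom J u v ->
  forall n1 n2, orthonormal_normal_frame z u v n1 n2 ->
    let c11 n := mink (d_u (d_u z) u v) n in
    let c12 n := mink (d_v (d_u z) u v) n in
    let c22 n := mink (d_v (d_v z) u v) n in
    ~ (c11 n1 * c12 n2 - c12 n1 * c11 n2 = 0 /\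
       c11 n1 * c22 n2 - c22 n1 * c11 n2 = 0 /\
       c12 n1 * c22 n2 - c22 n1 * c12 n2 = 0).

(** * General rotational surfaces and their meridian curves *)

Definition surface1 (alpha beta : R) (f g : R -> R) (u v : R) : R4 :=
  (f u * cos (alpha * v), f u * sin (alpha * v),
   g u * sinh (beta * v), g u * cosh (beta * v)).

Definition surface2 (alpha beta : R) (f g : R -> R) (u v : R) : R4 :=
  (f u * cos (alpha * v), f u * sin (alpha * v),
   g u * cosh (beta * v), g u * sinh (beta * v)).

Definition meridian1 (f g : R -> R) (u : R) : R4 := (f u, 0, 0, g u).
Definition meridian2 (f g : R -> R) (u : R) : R4 := (f u, 0, g u, 0).

(** On [J] the curve [c] is, up to a regular smooth change of parameter, (an
    arc of) the curve [c0] parametrized by [I]. *)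
Definition reparametrizes (J : R -> Prop) (c : R -> R4)
    (I : R -> Prop) (c0 : R -> R4) : Prop :=
  exists phi : R -> R,
    smooth_on J phi /\
    forall u, J u -> Derive phi u <> 0 /\ I (phi u) /\ c u = c0 (phi u).

(** f(s) = +/- sqrt (s^2 + C^2), one sign for the whole curve *)
Definition determined1 (J : R -> Prop) (f g : R -> R) (C : R) : Prop :=
  exists e, (e = 1 \/ e = -1) /\
    reparametrizes J (meridian1 f g) (fun _ => True)
      (meridian1 (fun s => e * sqrt (s ^ 2 + C ^ 2)) (fun s => s)).

(** f(s) = +/- sqrt (C^2 - s^2), s in (-C, C).  Such a curve does not meet
    the line x1 = 0. *)
Definition determined2 (J : R -> Prop) (f g : R -> R) (C : R) : Prop :=
  exists e, (e = 1 \/ e = -1) /\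
    reparametrizes J (meridian2 f g) (fun s => - C < s < C)
      (meridian2 (fun s => e * sqrt (C ^ 2 - s ^ 2)) (fun s => s)).

(* Main.v *)
Require Import Defs.
From Stdlib Require Import Reals Lra Psatz FunctionalExtensionality Ranalysis5.
From Coquelicot Require Import Coquelicot.
Open Scope R_scope.

(** Both families are one family.  A meridian lies in a plane with metric
    dx^2 + eps dy^2, where [eps = -1] for the first type and [eps = 1] for the
    second.  The surface is
    z = f e1 + g p for a frame (e1, e2, p, q) that depends on v alone and turns
    with v by e1' = alpha e2, e2' = - alpha e1, p' = beta q, q' = beta p.  The normal
    plane is spanned by N1 = g' e1 - eps f' p and N2 = beta g e2 + eps alpha f q; here
    z_uu and z_vv have no component along N2, hence H is a multiple of N1.

    The whole theorem reduces to one equivalence: the normalized mean curvature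
    vector field is parallel if and only if f^2 + eps g^2 is a positive constant
    C^2, that is, the surface lies in the quadric <x, x> = C^2 and the meridian is
    an arc of a conic.

    If the unit field xi along H is parallel, then <xi, N2> = 0 can be
    differentiated in v, and only <xi, (N2)_v> = 0 remains.  Since xi is
    proportional to N1, this says f f' + eps g g' = 0
    ([parallel_implies_orthogonal]), so f^2 + eps g^2 is constant; the
    assumption on the signature of the metric makes the constant positive
    ([parallel_implies_spherical]).

    Conversely, if f^2 + eps g^2 = C^2, then the position vector z is normal with
    <z, z> = C^2, and differentiating twice gives <z_uu, z> = - <z_u, z_u> and
    <z_vv, z> = - <z_v, z_v>.  So H = - z / C^2 ([mean_curvature_spherical]), the
    unit field is - z / |C|, and its derivatives are tangent, that is, it is
    parallel ([spherical_implies_parallel]).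

    What remains is to read the conic as a graph over g.  This is possible where f
    does not vanish: there f keeps its sign ([spherical_graph]) and g' <> 0
    ([spherical_regular]).  In the first type f never vanishes on the conic.  In
    the second type the arcs with f <> 0 determine the conic on all of J because
    the absence of inflection points forbids f and f' to vanish together
    ([spherical_of_nonzero]). *)

(** * Functions on an interval *)

Lemma interval_no_isolated_point (J : R -> Prop) (HJ : interval J) (u : R) (Hu : J u)
    (d : R) (Hd : 0 < d) :
  exists x, J x /\ x <> u /\ Rabs (x - u) < d.
Proof.
  destruct HJ as [[a [b [Hab [Ha Hb]]]] Hconv].
  assert (Hc : exists c, J c /\ c <> u).
  { destruct (Req_dec a u) as [->|Hn]; [exists b | exists a]; split; auto; lra. }
  destruct Hc as [c [Hc Hcu]].
  destruct (Rtotal_order c u) as [Hlt|[He|Hgt]]; [| lra |].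
  - exists (Rmax c (u - d / 2)).
    assert (H1 := Rmax_l c (u - d / 2)). assert (H2 := Rmax_r c (u - d / 2)).
    assert (H3 : Rmax c (u - d / 2) < u) by (apply Rmax_lub_lt; lra).
    repeat split; [apply (Hconv c u); auto; lra | lra |].
    rewrite Rabs_left; lra.
  - exists (Rmin c (u + d / 2)).
    assert (H1 := Rmin_l c (u + d / 2)). assert (H2 := Rmin_r c (u + d / 2)).
    assert (H3 : u < Rmin c (u + d / 2)) by (apply Rmin_glb_lt; lra).
    repeat split; [apply (Hconv u c); auto; lra | lra |].
    rewrite Rabs_right; lra.
Qed.

Lemma interval_inter_ball (J : R -> Prop) (HJ : interval J) (u : R) (Hu : J u)
    (d : R) (Hd : 0 < d) :
  interval (fun x => J x /\ Rabs (x - u) < d).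
Proof.
  split.
  - destruct (interval_no_isolated_point J HJ u Hu d Hd) as [x [Hx [Hne Hxd]]].
    assert (H0 : Rabs (u - u) < d) by (rewrite Rminus_diag, Rabs_R0; lra).
    destruct (Rtotal_order x u) as [H|[H|H]]; [exists x, u | lra | exists u, x];
      auto.
  - intros a b c [Ha Had] [Hb Hbd] Hc; split.
    + exact (proj2 HJ a b c Ha Hb Hc).
    + apply Rabs_def2 in Had; apply Rabs_def2 in Hbd; apply Rabs_def1; lra.
Qed.

(** At an endpoint of [J] the derivative is two-sided while [h] is known on one side
    only, so the value is read off from difference quotients towards points of
    [J]. *)
Lemma Derive_zero_on_interval (J : R -> Prop) (HJ : interval J) (h : R -> R) (k u : R)
    (Hu : J u) (Hk : forall x, J x -> h x = k) (Hd : ex_derive h u) :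
  Derive h u = 0.
Proof.
  destruct (Req_dec (Derive h u) 0) as [|Hne]; [assumption | exfalso].
  assert (Hlim : derivable_pt_lim h u (Derive h u))
    by now apply is_derive_Reals, Derive_correct.
  destruct (Hlim (Rabs (Derive h u)) (Rabs_pos_lt _ Hne)) as [d Hdel].
  destruct (interval_no_isolated_point J HJ u Hu d (cond_pos d)) as [x [Hx [Hxu Hxd]]].
  specialize (Hdel (x - u) ltac:(lra) Hxd).
  replace (u + (x - u)) with x in Hdel by ring.
  rewrite (Hk x Hx), (Hk u Hu) in Hdel.
  replace ((k - k) / (x - u) - Derive h u) with (- Derive h u) in Hdel
    by (field; lra).
  rewrite Rabs_Ropp in Hdel; lra.
Qed.

Lemma const_on_interval (J : R -> Prop) (HJ : interval J) (h : R -> R)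
    (Hd : forall u, J u -> is_derive h u 0) (a b : R) (Ha : J a) (Hb : J b) :
  h a = h b.
Proof.
  assert (Hlt : forall x y, J x -> J y -> x < y -> h x = h y).
  { intros x y Hx Hy Hxy; apply eq_is_derive; [|exact Hxy].
    intros t Ht; apply Hd, (proj2 HJ x y); auto. }
  destruct (Rtotal_order a b) as [H|[->|H]]; auto.
  symmetry; auto.
Qed.

Lemma constant_sign (J : R -> Prop) (HJ : interval J) (h : R -> R)
    (Hc : forall u, J u -> continuity_pt h u) (Hne : forall u, J u -> h u <> 0) :
  exists e, (e = 1 \/ e = -1) /\ forall u, J u -> 0 < e * h u.
Proof.
  destruct HJ as [[a [b [Hab [Ha Hb]]]] Hconv].
  assert (Hno : forall x y, J x -> J y -> h x < 0 -> 0 < h y -> False).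
  { intros x y Hx Hy Hnx Hpy.
    destruct (Rtotal_order x y) as [H|[->|H]]; [| lra |].
    - destruct (IVT_interv h x y) as [z [Hz Hz0]]; auto.
      + intros t Ht; apply Hc, (Hconv x y); auto.
      + apply (Hne z); [apply (Hconv x y)|]; auto.
    - destruct (IVT_interv (fun t => - h t) y x) as [z [Hz Hz0]]; try lra.
      + intros t Ht; apply continuity_pt_opp, Hc, (Hconv y x); auto.
      + apply (Hne z); [apply (Hconv y x)|]; auto; lra. }
  assert (Hna := Hne a Ha).
  destruct (Rtotal_order (h a) 0) as [H|[H|H]]; [exists (-1) | lra | exists 1];
    (split; [auto|]); intros u Hu; assert (Hnu := Hne u Hu);
    destruct (Rtotal_order (h u) 0) as [H'|[H'|H']]; try lra; exfalso.
  - exact (Hno a u Ha Hu H H').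
  - exact (Hno u a Hu Ha H' H).
Qed.

Lemma smooth_on_derive (J : R -> Prop) (h : R -> R) (Hh : smooth_on J h)
    (u : R) (Hu : J u) :
  ex_derive h u /\ ex_derive (Derive h) u.
Proof.
  assert (H := locally_singleton _ _ (Hh u Hu)).
  split; [exact (H 1%nat) | exact (H 2%nat)].
Qed.

Lemma ex_derive_continuity_pt (h : R -> R) (u : R) (Hd : ex_derive h u) :
  continuity_pt h u.
Proof.
  apply continuity_pt_filterlim, (ex_derive_continuous (V := R_NormedModule)); exact Hd.
Qed.

(** * Smoothness in two variables of products of one-variable functions *)

(** The hypotheses on the factors [p], [q] (trigonometric or hyperbolic functions)
    reproduce themselves under differentiation, which is what makes the induction
    on the order of differentiability go through. *)
Lemma ex_diff_n_mult_separate (n : nat) : forall (a p q : R -> R) (k m x y : R),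
  (forall t, is_derive p t (k * q t)) -> (forall t, is_derive q t (m * p t)) ->
  (forall j, ex_derive_n a j x) ->
  ex_diff_n (fun s t => a s * p t) n x y.
Proof.
  induction n as [|n IH]; intros a p q k m x y Hp Hq Ha.
  all: assert (Hcont : continuity_2d_pt (fun s t => a s * p t) x y).
  1, 3: apply continuity_2d_pt_mult;
    [ apply (continuity_1d_2d_pt_comp a (fun s _ => s));
      [apply ex_derive_continuity_pt, (Ha 1%nat) | apply continuity_2d_pt_id1]
    | apply (continuity_1d_2d_pt_comp p (fun _ t => t));
      [apply ex_derive_continuity_pt; eexists; apply Hp | apply continuity_2d_pt_id2]].
  - split; [exact Hcont | exact I].
  - split; [exact Hcont |].
    split; [|split; [|split]].
    + apply (ex_derive_mult (fun s => a s) (fun _ => p y));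
        [exact (Ha 1%nat) | apply ex_derive_const].
    + apply (ex_derive_mult (fun _ => a x) p);
        [apply ex_derive_const | eexists; apply Hp].
    + replace (fun s t => Derive (fun z => a z * p t) s)
        with (fun s t => Derive a s * p t).
      * apply (IH (Derive a) p q k m); auto.
        intros [|j]; [exact I|]. unfold ex_derive_n.
        apply ex_derive_ext with (Derive_n a (S j)); [|exact (Ha (S (S j)))].
        intros t. change (Derive a) with (Derive_n a 1).
        rewrite Derive_n_comp. f_equal. lia.
      * apply functional_extensionality; intro s.
        apply functional_extensionality; intro t.
        symmetry; apply Derive_scal_l.
    + replace (fun s t => Derive (fun z => a s * p z) t)
        with (fun s t => (k * a s) * q t).
      * apply (IH (fun s => k * a s) q p m k); auto.
        intros j. apply ex_derive_n_scal_l, Ha.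
      * apply functional_extensionality; intro s.
        apply functional_extensionality; intro t.
        rewrite Derive_scal, (is_derive_unique _ _ _ (Hp t)). ring.
Qed.

Lemma smooth2_mult_separate (J : R -> Prop) (a p q : R -> R) (k m u v : R)
    (Ha : smooth_on J a) (Hu : J u)
    (Hp : forall t, is_derive p t (k * q t)) (Hq : forall t, is_derive q t (m * p t)) :
  smooth2 (fun s t => a s * p t) u v.
Proof.
  destruct (Ha u Hu) as [d Hd].
  exists d; intros x y Hx Hy n.
  apply (ex_diff_n_mult_separate n a p q k m); auto.
Qed.

(** * Bilinear algebra in Minkowski space *)

Lemma R4_ext (a b : R4) (H1 : x1 a = x1 b) (H2 : x2 a = x2 b) (H3 : x3 a = x3 b)
    (H4 : x4 a = x4 b) : a = b.
Proof.
  destruct a as [[[a1 a2] a3] a4], b as [[[b1 b2] b3] b4].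
  unfold x1, x2, x3, x4 in *; simpl in *; congruence.
Qed.

Lemma mink_sym (a b : R4) : mink a b = mink b a.
Proof. unfold mink; ring. Qed.

Lemma mink_plus_l (a b c : R4) : mink (plus a b) c = mink a c + mink b c.
Proof.
  destruct a as [[[a1 a2] a3] a4], b as [[[b1 b2] b3] b4].
  unfold mink, x1, x2, x3, x4, plus; simpl; unfold plus; simpl; ring.
Qed.

Lemma mink_scal_l (k : R) (a c : R4) : mink (scal k a) c = k * mink a c.
Proof.
  destruct a as [[[a1 a2] a3] a4].
  unfold mink, x1, x2, x3, x4, scal; simpl; unfold scal; simpl; unfold mult; simpl; ring.
Qed.

Lemma mink_minus_l (a b c : R4) : mink (minus a b) c = mink a c - mink b c.
Proof.
  destruct a as [[[a1 a2] a3] a4], b as [[[b1 b2] b3] b4].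
  unfold mink, x1, x2, x3, x4, minus, plus, opp; simpl.
  unfold plus, opp; simpl; ring.
Qed.

Lemma mink_zero_l (c : R4) : mink zero c = 0.
Proof. unfold mink, zero, x1, x2, x3, x4; simpl; unfold zero; simpl; ring. Qed.

Lemma mink_normal_part (z : R -> R -> R4) (u v : R) (w n : R4) (Hn : normal_at z u v n) :
  mink (normal_part z u v w) n = mink w n.
Proof.
  destruct Hn as [H1 H2].
  unfold normal_part, tangential_part.
  rewrite mink_minus_l, mink_plus_l, !mink_scal_l,
    (mink_sym (d_u z u v)), (mink_sym (d_v z u v)), H1, H2; ring.
Qed.

(** This is what makes a normal field whose derivatives are tangent parallel in
    the normal bundle. *)
Lemma normal_part_tangent (z : R -> R -> R4) (a b u v : R)
    (Hdet : fE z u v * fG z u v - fF z u v ^ 2 <> 0) :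
  normal_part z u v (plus (scal a (d_u z u v)) (scal b (d_v z u v))) = zero.
Proof.
  unfold normal_part, tangential_part.
  rewrite !mink_plus_l, !mink_scal_l, (mink_sym (d_v z u v) (d_u z u v)).
  fold (fE z u v) (fF z u v) (fG z u v).
  replace ((fG z u v * (a * fE z u v + b * fF z u v)
      - fF z u v * (a * fF z u v + b * fG z u v))
      / (fE z u v * fG z u v - fF z u v ^ 2)) with a by (field; exact Hdet).
  replace ((fE z u v * (a * fF z u v + b * fG z u v)
      - fF z u v * (a * fE z u v + b * fF z u v))
      / (fE z u v * fG z u v - fF z u v ^ 2)) with b by (field; exact Hdet).
  exact (minus_eq_zero (G := prod_AbelianGroup (prod_AbelianGroup
    (prod_AbelianGroup R_AbelianGroup R_AbelianGroup) R_AbelianGroup) R_AbelianGroup) _).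
Qed.

(** The component of H along a normal vector needs only the second derivatives of
    [z], without their tangential corrections. *)
Lemma mink_mean_curvature (z : R -> R -> R4) (u v : R) (n : R4) (Hn : normal_at z u v n) :
  mink (mean_curvature z u v) n =
  / 2 * / (fE z u v * fG z u v - fF z u v ^ 2) *
  (fG z u v * mink (d_u (d_u z) u v) n - 2 * fF z u v * mink (d_v (d_u z) u v) n
   + fE z u v * mink (d_v (d_v z) u v) n).
Proof.
  unfold mean_curvature, sigma_uu, sigma_uv, sigma_vv.
  rewrite mink_scal_l, !mink_plus_l, !mink_scal_l, !mink_normal_part by exact Hn.
  ring.
Qed.

Lemma is_derive_mink (w n : R -> R -> R4) (u v : R)
    (Hw : ex_derive (fun t => x1 (w u t)) v /\ ex_derive (fun t => x2 (w u t)) v /\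
          ex_derive (fun t => x3 (w u t)) v /\ ex_derive (fun t => x4 (w u t)) v)
    (Hn : ex_derive (fun t => x1 (n u t)) v /\ ex_derive (fun t => x2 (n u t)) v /\
          ex_derive (fun t => x3 (n u t)) v /\ ex_derive (fun t => x4 (n u t)) v) :
  is_derive (fun t => mink (w u t) (n u t)) v
    (mink (d_v w u v) (n u v) + mink (w u v) (d_v n u v)).
Proof.
  destruct Hw as (W1 & W2 & W3 & W4), Hn as (N1 & N2 & N3 & N4).
  assert (Hmul : forall a b : R -> R, ex_derive a v -> ex_derive b v ->
    is_derive (fun t => a t * b t) v (Derive a v * b v + a v * Derive b v)).
  { intros a b Ha Hb.
    apply (is_derive_mult (K := R_AbsRing) a b); [| | exact Rmult_comm];
      apply Derive_correct; assumption. }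
  assert (H := is_derive_minus _ _ _ _ _ (is_derive_plus _ _ _ _ _
    (is_derive_plus _ _ _ _ _ (Hmul _ _ W1 N1) (Hmul _ _ W2 N2)) (Hmul _ _ W3 N3))
    (Hmul _ _ W4 N4)).
  match type of H with is_derive _ _ ?l =>
    replace (mink (d_v w u v) (n u v) + mink (w u v) (d_v n u v)) with l end.
  - exact H.
  - unfold mink, d_v, x1, x2, x3, x4, minus, plus, opp; simpl; ring.
Qed.

(** In a plane with metric dx^2 + eps dy^2, two orthogonal vectors of non-zero
    length form a basis, so removing from a vector its component along one of
    them leaves its component along the other. *)
Lemma planar_decomposition (eps F G F' G' a c : R)
    (Horth : F * F' + eps * (G * G') = 0)
    (HE : F' ^ 2 + eps * G' ^ 2 <> 0) (HK : F ^ 2 + eps * G ^ 2 <> 0) :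
  let p := (a * F' + eps * (c * G')) / (F' ^ 2 + eps * G' ^ 2) in
  let s := (a * F + eps * (c * G)) / (F ^ 2 + eps * G ^ 2) in
  a - p * F' = s * F /\ c - p * G' = s * G.
Proof.
  intros p s; unfold p, s.
  split; apply Rminus_diag_uniq.
  - transitivity ((F * F' + eps * (G * G')) *
      (a * (eps * G * G' - F * F') - eps * c * (F * G' + F' * G)) /
      ((F' ^ 2 + eps * G' ^ 2) * (F ^ 2 + eps * G ^ 2))); [field; auto|].
    rewrite Horth; field; auto.
  - transitivity ((F * F' + eps * (G * G')) *
      (c * (F * F' - eps * G * G') - a * (F * G' + F' * G)) /
      ((F' ^ 2 + eps * G' ^ 2) * (F ^ 2 + eps * G ^ 2))); [field; auto|].
    rewrite Horth; field; auto.
Qed.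

(** * Moving frames of general rotational surfaces *)

Section RotationalSurface.

Variables (eps alpha beta : R) (P Q : R -> R).
Hypothesis (Heps : eps = 1 \/ eps = -1).
Hypothesis (Halpha : 0 < alpha) (Hbeta : 0 < beta).
Hypothesis (HP : forall v, is_derive P v (beta * Q v)).
Hypothesis (HQ : forall v, is_derive Q v (beta * P v)).
Hypothesis (HPQ : forall v, P v * P v - Q v * Q v = eps).

(** Coordinates (a, b, c, d) with respect to e1 = (cos, sin, 0, 0),
    e2 = (- sin, cos, 0, 0), p = (0, 0, P, Q), q = (0, 0, Q, P) at [v]; of these only
    p and q have lengths depending on the type, <p, p> = eps = - <q, q>. *)
Definition frame (a b c d v : R) : R4 :=
  (a * cos (alpha * v) - b * sin (alpha * v),
   a * sin (alpha * v) + b * cos (alpha * v),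
   c * P v + d * Q v, c * Q v + d * P v).

Lemma frame_plus (a b c d a' b' c' d' v : R) :
  plus (frame a b c d v) (frame a' b' c' d' v) =
  frame (a + a') (b + b') (c + c') (d + d') v.
Proof.
  apply R4_ext; unfold frame, x1, x2, x3, x4, plus; simpl; unfold plus; simpl; ring.
Qed.

Lemma frame_minus (a b c d a' b' c' d' v : R) :
  minus (frame a b c d v) (frame a' b' c' d' v) =
  frame (a - a') (b - b') (c - c') (d - d') v.
Proof.
  apply R4_ext; unfold frame, x1, x2, x3, x4, minus, plus, opp; simpl;
    unfold plus, opp; simpl; ring.
Qed.

Lemma frame_scal (k a b c d v : R) :
  scal k (frame a b c d v) = frame (k * a) (k * b) (k * c) (k * d) v.
Proof.
  apply R4_ext; unfold frame, x1, x2, x3, x4, scal; simpl; unfold scal; simpl;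
    unfold mult; simpl; ring.
Qed.

Lemma eps_sqr : eps * eps = 1.
Proof. destruct Heps as [-> | ->]; ring. Qed.

Lemma mink_frame (a b c d a' b' c' d' v : R) :
  mink (frame a b c d v) (frame a' b' c' d' v) =
  a * a' + b * b' + eps * (c * c' - d * d').
Proof.
  unfold mink, frame, x1, x2, x3, x4; simpl.
  transitivity ((a * a' + b * b') * (Rsqr (sin (alpha * v)) + Rsqr (cos (alpha * v)))
    + (P v * P v - Q v * Q v) * (c * c' - d * d')); [unfold Rsqr; ring|].
  rewrite sin2_cos2, HPQ; ring.
Qed.

Lemma frame_onto (w : R4) (v : R) : exists a b c d, w = frame a b c d v.
Proof.
  destruct w as [[[w1 w2] w3] w4].
  exists (w1 * cos (alpha * v) + w2 * sin (alpha * v)),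
    (- w1 * sin (alpha * v) + w2 * cos (alpha * v)),
    (eps * (w3 * P v - w4 * Q v)), (eps * (w4 * P v - w3 * Q v)).
  unfold frame.
  assert (Hcs := sin2_cos2 (alpha * v)); unfold Rsqr in Hcs.
  assert (H1 := HPQ v). assert (H2 := eps_sqr).
  f_equal; [f_equal; [f_equal|]|].
  - transitivity (w1 * (sin (alpha * v) * sin (alpha * v)
      + cos (alpha * v) * cos (alpha * v)));
      [rewrite Hcs|]; ring.
  - transitivity (w2 * (sin (alpha * v) * sin (alpha * v)
      + cos (alpha * v) * cos (alpha * v)));
      [rewrite Hcs|]; ring.
  - transitivity (w3 * (eps * (P v * P v - Q v * Q v))); [rewrite H1, H2|]; ring.
  - transitivity (w4 * (eps * (P v * P v - Q v * Q v))); [rewrite H1, H2|]; ring.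
Qed.

Lemma d_v_frame (a b c d : R -> R) :
  d_v (fun u v => frame (a u) (b u) (c u) (d u) v) =
  (fun u v => frame (- alpha * b u) (alpha * a u) (beta * d u) (beta * c u) v).
Proof.
  apply functional_extensionality; intro u.
  apply functional_extensionality; intro v.
  unfold d_v, frame, x1, x2, x3, x4; simpl.
  assert (EP : ex_derive P v) by (eexists; apply HP).
  assert (EQ : ex_derive Q v) by (eexists; apply HQ).
  assert (DP := is_derive_unique _ _ _ (HP v)).
  assert (DQ := is_derive_unique _ _ _ (HQ v)).
  f_equal; [f_equal; [f_equal|]|]; apply is_derive_unique; auto_derive; auto;
    try (change (Derive (fun x => P x) v) with (Derive P v);
         change (Derive (fun x => Q x) v) with (Derive Q v);
         rewrite DP, DQ); ring.
Qed.

(** With two coefficients equal to zero, each entry is a single function of [u]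
    times a constant, and [Derive] commutes with such a product for every
    function, differentiable or not. *)
Lemma d_u_frame (a c : R -> R) :
  d_u (fun u v => frame (a u) 0 (c u) 0 v) =
  (fun u v => frame (Derive a u) 0 (Derive c u) 0 v).
Proof.
  apply functional_extensionality; intro u.
  apply functional_extensionality; intro v.
  unfold d_u, frame, x1, x2, x3, x4; simpl.
  assert (H : forall (a : R -> R) (p r : R), r = 0 ->
    Derive (fun t => a t * p + r) u = Derive a u * p + r).
  { intros h p r ->. rewrite Rplus_0_r, <- Derive_scal_l.
    apply Derive_ext; intro; ring. }
  unfold Rminus; f_equal; [f_equal; [f_equal|]|]; apply H; ring.
Qed.

Lemma ex_derive_v_frame (a b c d : R -> R) (u v : R) :
  let w := fun u v => frame (a u) (b u) (c u) (d u) v in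
  ex_derive (fun t => x1 (w u t)) v /\ ex_derive (fun t => x2 (w u t)) v /\
  ex_derive (fun t => x3 (w u t)) v /\ ex_derive (fun t => x4 (w u t)) v.
Proof.
  unfold frame, x1, x2, x3, x4; simpl.
  assert (EP : ex_derive P v) by (eexists; apply HP).
  assert (EQ : ex_derive Q v) by (eexists; apply HQ).
  repeat split; auto_derive; auto.
Qed.

(** * First and second order geometry of the surfaces *)

Variables (f g : R -> R).

Definition rotational (u v : R) : R4 := frame (f u) 0 (g u) 0 v.

Definition first_form_uu (u : R) : R := Derive f u ^ 2 + eps * Derive g u ^ 2.
Definition first_form_vv (u : R) : R := alpha ^ 2 * f u ^ 2 - eps * (beta ^ 2 * g u ^ 2).

Lemma d_u_rotational : d_u rotational = fun u v => frame (Derive f u) 0 (Derive g u) 0 v.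
Proof. apply d_u_frame. Qed.

Lemma d_v_rotational : d_v rotational = fun u v => frame 0 (alpha * f u) 0 (beta * g u) v.
Proof.
  unfold rotational; rewrite (d_v_frame f (fun _ => 0) g (fun _ => 0)).
  do 2 (apply functional_extensionality; intro). f_equal; ring.
Qed.

Lemma d_uu_rotational :
  d_u (d_u rotational) = fun u v => frame (Derive (Derive f) u) 0 (Derive (Derive g) u) 0 v.
Proof. rewrite d_u_rotational; apply d_u_frame. Qed.

Lemma d_uv_rotational :
  d_v (d_u rotational) =
  fun u v => frame 0 (alpha * Derive f u) 0 (beta * Derive g u) v.
Proof.
  rewrite d_u_rotational, (d_v_frame (Derive f) (fun _ => 0) (Derive g) (fun _ => 0)).
  do 2 (apply functional_extensionality; intro). f_equal; ring.
Qed.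

Lemma d_vv_rotational :
  d_v (d_v rotational) = fun u v => frame (- alpha ^ 2 * f u) 0 (beta ^ 2 * g u) 0 v.
Proof.
  rewrite d_v_rotational, (d_v_frame (fun _ => 0) (fun u => alpha * f u)
    (fun _ => 0) (fun u => beta * g u)).
  do 2 (apply functional_extensionality; intro). f_equal; ring.
Qed.

Lemma fE_rotational (u v : R) : fE rotational u v = first_form_uu u.
Proof. unfold fE, first_form_uu; rewrite d_u_rotational, mink_frame; ring. Qed.

Lemma fF_rotational (u v : R) : fF rotational u v = 0.
Proof. unfold fF; rewrite d_u_rotational, d_v_rotational, mink_frame; ring. Qed.

Lemma fG_rotational (u v : R) : fG rotational u v = first_form_vv u.
Proof. unfold fG, first_form_vv; rewrite d_v_rotational, mink_frame; ring. Qed.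

Definition normal_field1 (u v : R) : R4 :=
  frame (Derive g u) 0 (- eps * Derive f u) 0 v.

Definition normal_field2 (u v : R) : R4 :=
  frame 0 (beta * g u) 0 (eps * (alpha * f u)) v.

Lemma normal_normal_field1 (u v : R) : normal_at rotational u v (normal_field1 u v).
Proof.
  unfold normal_at, normal_field1; rewrite d_u_rotational, d_v_rotational, !mink_frame.
  assert (H := eps_sqr); split; [|ring].
  transitivity (Derive f u * Derive g u * (1 - eps * eps)); [ring|rewrite H; ring].
Qed.

Lemma normal_normal_field2 (u v : R) : normal_at rotational u v (normal_field2 u v).
Proof.
  unfold normal_at, normal_field2; rewrite d_u_rotational, d_v_rotational, !mink_frame.
  assert (H := eps_sqr); split; [ring|].
  transitivity (alpha * beta * f u * g u * (1 - eps * eps)); [ring|rewrite H; ring].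
Qed.

Lemma sqnorm_normal_field1 (u v : R) :
  mink (normal_field1 u v) (normal_field1 u v) = eps * first_form_uu u.
Proof.
  unfold normal_field1, first_form_uu; rewrite mink_frame; destruct Heps as [-> | ->]; ring.
Qed.

Lemma sqnorm_normal_field2 (u v : R) :
  mink (normal_field2 u v) (normal_field2 u v) = - eps * first_form_vv u.
Proof.
  unfold normal_field2, first_form_vv; rewrite mink_frame; destruct Heps as [-> | ->]; ring.
Qed.

(** The second derivatives z_uu and z_vv stay in the plane of e1 and p, and N2 is
    orthogonal to that plane. *)
Lemma mean_curvature_normal_field2 (u v : R) :
  mink (mean_curvature rotational u v) (normal_field2 u v) = 0.
Proof.
  rewrite mink_mean_curvature by apply normal_normal_field2.
  rewrite fF_rotational, d_uu_rotational, d_vv_rotational.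
  unfold normal_field2; rewrite !mink_frame; ring.
Qed.

(** * Parallel normalized mean curvature forces the meridian to be a conic *)

Variable (J : R -> Prop).
Hypothesis (HJ : interval J) (Hf : smooth_on J f) (Hg : smooth_on J g).
Hypothesis (HE : forall u, J u -> 0 < eps * first_form_uu u).
Hypothesis (HG : forall u, J u -> 0 < - eps * first_form_vv u).

(** In the frame N1, N2 the only entry of the second fundamental form along N2 is
    <z_uv, N2> = alpha beta (f' g - f g'); if it vanishes, sigma takes values in
    the line of N1 and all three determinants are zero. *)
Lemma no_inflection_wronskian (Hinf : no_inflection_points J rotational) (u : R)
    (Hu : J u) :
  Derive f u * g u - f u * Derive g u <> 0.
Proof.
  intros Hw.
  set (r1 := sqrt (eps * first_form_uu u)). set (r2 := sqrt (- eps * first_form_vv u)).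
  assert (R1 : r1 * r1 = eps * first_form_uu u) by (apply sqrt_sqrt; left; auto).
  assert (R2 : r2 * r2 = - eps * first_form_vv u) by (apply sqrt_sqrt; left; auto).
  assert (P1 : 0 < r1) by (apply sqrt_lt_R0; auto).
  assert (P2 : 0 < r2) by (apply sqrt_lt_R0; auto).
  assert (Hdom : dom J u 0) by (split; [exact Hu | assert (H := PI_RGT_0); lra]).
  apply (Hinf u 0 Hdom (scal (/ r1) (normal_field1 u 0)) (scal (/ r2) (normal_field2 u 0))).
  - destruct (normal_normal_field1 u 0) as [A1 A2], (normal_normal_field2 u 0) as [B1 B2].
    repeat split; rewrite ?mink_scal_l, ?A1, ?A2, ?B1, ?B2; try ring;
      rewrite mink_sym, mink_scal_l.
    + rewrite sqnorm_normal_field1, <- R1; field; lra.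
    + rewrite sqnorm_normal_field2, <- R2; field; lra.
    + unfold normal_field1, normal_field2; rewrite mink_frame; ring.
  - assert (Z12 : mink (d_v (d_u rotational) u 0) (scal (/ r1) (normal_field1 u 0)) = 0).
    { rewrite mink_sym, mink_scal_l, d_uv_rotational; unfold normal_field1.
      rewrite mink_frame; ring. }
    assert (Z22 : mink (d_v (d_u rotational) u 0) (scal (/ r2) (normal_field2 u 0)) = 0).
    { rewrite mink_sym, mink_scal_l, d_uv_rotational; unfold normal_field2.
      rewrite mink_frame.
      transitivity (/ r2 * (alpha * beta *
        (Derive f u * g u - (eps * eps) * (f u * Derive g u)))); [ring|].
      rewrite eps_sqr, Rmult_1_l, Hw; ring. }
    assert (Z1 : mink (d_u (d_u rotational) u 0) (scal (/ r2) (normal_field2 u 0)) = 0).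
    { rewrite mink_sym, mink_scal_l, d_uu_rotational; unfold normal_field2.
      rewrite mink_frame; ring. }
    assert (Z2 : mink (d_v (d_v rotational) u 0) (scal (/ r2) (normal_field2 u 0)) = 0).
    { rewrite mink_sym, mink_scal_l, d_vv_rotational; unfold normal_field2.
      rewrite mink_frame; ring. }
    cbv zeta; rewrite Z12, Z22, Z1, Z2; repeat split; ring.
Qed.

(** Along a coordinate line u = const, the derivative of <xi, N2> = 0 has the term
    <xi_v, N2>, which is zero because xi is parallel.  The other term
    <xi, (N2)_v> = 0 is, up to a non-zero factor, f f' + eps g g' = 0.  Only
    derivatives in v are used, so [u] may be an endpoint of [J]. *)
Lemma parallel_implies_orthogonal (Hpar : parallel_normalized_mean_curvature J rotational)
    (u : R) (Hu : J u) :
  f u * Derive f u + eps * (g u * Derive g u) = 0.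
Proof.
  destruct Hpar as [_ [xi [Hunit [Hsm [Hnor Hcon]]]]].
  assert (Hpi := PI_RGT_0).
  (* v = PI is interior to [0, 2 PI), so derivatives in v see the field only there *)
  assert (Hdom : dom J u PI) by (split; [exact Hu | lra]).
  assert (Hxn : forall v, dom J u v -> mink (xi u v) (normal_field2 u v) = 0).
  { intros v Hv; destruct (Hunit u v Hv) as [_ [l [_ ->]]].
    rewrite mink_scal_l, mean_curvature_normal_field2; ring. }
  assert (Hex : ex_derive (fun t => x1 (xi u t)) PI /\ ex_derive (fun t => x2 (xi u t)) PI /\
                ex_derive (fun t => x3 (xi u t)) PI /\ ex_derive (fun t => x4 (xi u t)) PI).
  { destruct (Hsm u PI Hdom) as (S1 & S2 & S3 & S4).
    repeat split;
      [apply locally_2d_singleton in S1; destruct (S1 1%nat) as (_ & _ & H & _)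
      |apply locally_2d_singleton in S2; destruct (S2 1%nat) as (_ & _ & H & _)
      |apply locally_2d_singleton in S3; destruct (S3 1%nat) as (_ & _ & H & _)
      |apply locally_2d_singleton in S4; destruct (S4 1%nat) as (_ & _ & H & _)];
      exact H. }
  assert (Hd := is_derive_mink xi normal_field2 u PI Hex
    (ex_derive_v_frame (fun _ => 0) (fun u => beta * g u) (fun _ => 0)
       (fun u => eps * (alpha * f u)) u PI)).
  assert (Hd0 : is_derive (fun t => mink (xi u t) (normal_field2 u t)) PI 0).
  { apply (is_derive_ext_loc (fun _ => 0)); [|apply (is_derive_const (V := R_NormedModule))].
    exists (mkposreal PI Hpi); intros t Ht; symmetry; apply Hxn; split; [exact Hu|].
    change (Rabs (t - PI) < PI) in Ht; apply Rabs_def2 in Ht; lra. }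
  apply is_derive_unique in Hd; apply is_derive_unique in Hd0.
  rewrite Hd0 in Hd.
  assert (Hxv : mink (d_v xi u PI) (normal_field2 u PI) = 0).
  { assert (H := f_equal (fun w => mink w (normal_field2 u PI)) (Hcon u PI Hdom 0 1)).
    simpl in H; unfold normal_connection in H.
    rewrite mink_normal_part, mink_zero_l, mink_plus_l, !mink_scal_l in H
      by apply normal_normal_field2.
    lra. }
  rewrite Hxv, Rplus_0_l in Hd.
  destruct (Hunit u PI Hdom) as [Hone _].
  specialize (Hxn PI Hdom).
  destruct (Hnor u PI Hdom) as [Hnu Hnv].
  unfold normal_field2 in Hd, Hxn.
  rewrite (d_v_frame (fun _ => 0) (fun u => beta * g u) (fun _ => 0)
       (fun u => eps * (alpha * f u))) in Hd.
  destruct (frame_onto (xi u PI) PI) as (a & b & c & d & Hx).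
  rewrite d_u_rotational in Hnu. rewrite d_v_rotational in Hnv.
  rewrite Hx, mink_frame in Hd, Hxn, Hnu, Hnv, Hone.
  assert (HGu := HG u Hu). unfold first_form_vv in HGu.
  clear Hx Hd0 Hex Hxv Hsm Hnor Hcon Hunit.
  set (F := f u) in *; set (G := g u) in *.
  set (F' := Derive f u) in *; set (G' := Derive g u) in *.
  assert (He := eps_sqr).
  assert (Hb1 : b * (alpha * F) = eps * d * (beta * G)) by lra.
  assert (Hd1 : b * (beta * G) = eps * eps * d * (alpha * F)) by lra.
  rewrite He in Hd1.
  assert (Hdet : alpha ^ 2 * F ^ 2 - eps * (beta ^ 2 * G ^ 2) <> 0)
    by (intro H; rewrite H in HGu; lra).
  (* xi has no component in the plane of e2 and q, which z_v and N2 span *)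
  assert (b = 0).
  { apply Rmult_eq_reg_r with (2 := Hdet).
    transitivity (b * (alpha * F) * (alpha * F) - eps * (b * (beta * G)) * (beta * G)); [ring|].
    rewrite Hb1, Hd1; ring. }
  assert (d = 0).
  { apply Rmult_eq_reg_r with (2 := Hdet).
    transitivity (1 * d * (alpha * F) * (alpha * F) - eps * d * (beta * G) * (beta * G)); [ring|].
    rewrite <- Hd1, <- Hb1; ring. }
  subst b d.
  assert (Hac : a * G = c * F).
  { assert (Hab : alpha * beta <> 0) by nra.
    apply Rmult_eq_reg_l with (2 := Hab).
    transitivity (eps * eps * (alpha * beta * (c * F))); [lra | rewrite He; ring]. }
  assert (Hu1 : a * F' = - eps * c * G') by lra.
  assert (H1 : a * (F * F' + eps * (G * G')) = 0).
  { transitivity (F * (a * F') + eps * (a * G) * G'); [ring|]. rewrite Hu1, Hac; ring. }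
  assert (H2 : c * (F * F' + eps * (G * G')) = 0).
  { transitivity (c * F * F' + eps * c * G' * G); [ring|].
    rewrite <- Hac. transitivity (G * (a * F') + eps * c * G' * G); [ring|].
    rewrite Hu1; ring. }
  (* a^2 + eps c^2 = <xi, xi> = 1 *)
  transitivity ((a * a + eps * (c * c)) * (F * F' + eps * (G * G'))).
  - replace (a * a + eps * (c * c)) with 1 by lra; ring.
  - transitivity (a * (a * (F * F' + eps * (G * G')))
      + eps * c * (c * (F * F' + eps * (G * G')))); [ring|]. rewrite H1, H2; ring.
Qed.

Definition spherical (C : R) (I : R -> Prop) : Prop :=
  forall u, I u -> f u ^ 2 + eps * g u ^ 2 = C ^ 2.

Lemma is_derive_radius (u : R) (Hu : J u) :
  is_derive (fun t => f t ^ 2 + eps * g t ^ 2) u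
    (2 * (f u * Derive f u + eps * (g u * Derive g u))).
Proof.
  destruct (smooth_on_derive J f Hf u Hu) as [Df _].
  destruct (smooth_on_derive J g Hg u Hu) as [Dg _].
  auto_derive; [repeat split; assumption|].
  change (Derive (fun x => f x) u) with (Derive f u).
  change (Derive (fun x => g x) u) with (Derive g u).
  ring.
Qed.

Lemma first_form_uu_neq (u : R) (Hu : J u) : first_form_uu u <> 0.
Proof. intro H; assert (H' := HE u Hu); rewrite H in H'; lra. Qed.

Lemma first_form_vv_neq (u : R) (Hu : J u) : first_form_vv u <> 0.
Proof. intro H; assert (H' := HG u Hu); rewrite H in H'; lra. Qed.

(** Positivity of the constant K = f^2 + eps g^2 comes from
    (eps E) K = eps (f f' + eps g g')^2 + (f g' - g f')^2 with E = <z_u, z_u>, where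
    eps E > 0 and the first square vanishes; K = 0 would make both f and g zero. *)
Lemma parallel_implies_spherical (Hpar : parallel_normalized_mean_curvature J rotational) :
  exists C, 0 < C /\ spherical C J.
Proof.
  assert (Horth := parallel_implies_orthogonal Hpar).
  destruct HJ as [[a [_ [_ [Ha _]]]] _].
  set (h := fun t => f t ^ 2 + eps * g t ^ 2).
  assert (Hconst : forall u, J u -> h u = h a).
  { intros u Hu; apply (const_on_interval J HJ); auto.
    intros t Ht; replace 0 with (2 * (f t * Derive f t + eps * (g t * Derive g t)));
      [apply is_derive_radius; auto | rewrite Horth; auto; ring]. }
  assert (Hpos : 0 < h a).
  { specialize (Horth a Ha). assert (HEa := HE a Ha). assert (HGa := HG a Ha).
    unfold h, first_form_uu, first_form_vv in *.
    set (F := f a) in *; set (G := g a) in *.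
    set (F' := Derive f a) in *; set (G' := Derive g a) in *.
    assert (Hprod : (eps * (F' ^ 2 + eps * G' ^ 2)) * (F ^ 2 + eps * G ^ 2) =
      (F * G' - G * F') ^ 2).
    { transitivity (eps * (F * F' + eps * (G * G')) ^ 2
        + (eps * eps) * (F * G' - G * F') ^ 2); [ring|].
      rewrite Horth, eps_sqr; ring. }
    destruct (Rtotal_order (F ^ 2 + eps * G ^ 2) 0) as [H|[H|H]]; [| |lra].
    - assert (0 <= (F * G' - G * F') ^ 2) by apply pow2_ge_0. nra.
    - exfalso. rewrite H, Rmult_0_r in Hprod.
      assert (Hw : F * G' - G * F' = 0)
        by (destruct (Req_dec (F * G' - G * F') 0) as [|Hne]; auto;
            exfalso; apply (pow_nonzero _ 2 Hne); auto).
      assert (HF : F = 0).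
      { apply Rmult_eq_reg_r with (eps * (F' ^ 2 + eps * G' ^ 2)); [|lra].
        transitivity (eps * F' * (F * F' + eps * (G * G'))
          + eps * eps * G' * (F * G' - G * F')); [ring|]. rewrite Horth, Hw; ring. }
      assert (HGz : G = 0).
      { apply Rmult_eq_reg_r with (eps * (F' ^ 2 + eps * G' ^ 2)); [|lra].
        transitivity (eps * G' * (F * F' + eps * (G * G'))
          - eps * F' * (F * G' - G * F')); [ring|]. rewrite Horth, Hw; ring. }
      rewrite HF, HGz in HGa. nra. }
  exists (sqrt (h a)); split; [apply sqrt_lt_R0; auto|].
  intros u Hu; rewrite pow2_sqrt by lra. apply Hconst; auto.
Qed.

(** * On a conic the mean curvature vector is the position vector *)

Lemma spherical_orthogonal (C : R) (Hsph : spherical C J) (u : R) (Hu : J u) :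
  f u * Derive f u + eps * (g u * Derive g u) = 0.
Proof.
  assert (H := is_derive_radius u Hu).
  assert (H0 := Derive_zero_on_interval J HJ _ (C ^ 2) u Hu Hsph (ex_intro _ _ H)).
  assert (H1 := eq_trans (eq_sym (is_derive_unique _ _ _ H)) H0); lra.
Qed.

Lemma spherical_second (C : R) (Hsph : spherical C J) (u : R) (Hu : J u) :
  Derive (Derive f) u * f u + eps * (Derive (Derive g) u * g u) = - first_form_uu u.
Proof.
  destruct (smooth_on_derive J f Hf u Hu) as [Df DDf].
  destruct (smooth_on_derive J g Hg u Hu) as [Dg DDg].
  set (f1 := Derive f) in *; set (g1 := Derive g) in *.
  assert (H : is_derive (fun t => f t * f1 t + eps * (g t * g1 t)) u
    (Derive f1 u * f u + eps * (Derive g1 u * g u) + first_form_uu u)).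
  { unfold first_form_uu; fold f1 g1; auto_derive; [repeat split; assumption|].
    change (Derive (fun x => f x) u) with (f1 u).
    change (Derive (fun x => g x) u) with (g1 u).
    change (Derive (fun x => f1 x) u) with (Derive f1 u).
    change (Derive (fun x => g1 x) u) with (Derive g1 u).
    ring. }
  assert (H0 := Derive_zero_on_interval J HJ _ 0 u Hu
    (spherical_orthogonal C Hsph) (ex_intro _ _ H)).
  assert (H1 := eq_trans (eq_sym (is_derive_unique _ _ _ H)) H0); lra.
Qed.

(** The position vector is normal, and together with z_u it is an orthogonal basis
    of the plane of e1 and p; so the normal part of a vector of that plane is its
    component along z. *)
Lemma normal_part_spherical (C : R) (HC : C <> 0) (Hsph : spherical C J)
    (a c u v : R) (Hu : J u) :
  normal_part rotational u v (frame a 0 c 0 v) =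
  scal ((a * f u + eps * (c * g u)) / C ^ 2) (rotational u v).
Proof.
  assert (HEu := first_form_uu_neq u Hu). assert (HGu := first_form_vv_neq u Hu).
  assert (HK : f u ^ 2 + eps * g u ^ 2 <> 0)
    by (rewrite (Hsph u Hu); apply pow_nonzero, HC).
  destruct (planar_decomposition eps (f u) (g u) (Derive f u) (Derive g u) a c
    (spherical_orthogonal C Hsph u Hu) HEu HK) as [H1 H2].
  rewrite (Hsph u Hu) in H1, H2. fold (first_form_uu u) in H1, H2.
  unfold normal_part, tangential_part.
  rewrite fE_rotational, fF_rotational, fG_rotational, d_u_rotational, d_v_rotational,
    !mink_frame.
  unfold rotational. rewrite !frame_scal, frame_plus, frame_minus.
  f_equal; [rewrite <- H1| |rewrite <- H2|]; field; auto.
Qed.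

(** By [normal_part_spherical], sigma(z_u, z_u) = - E z / C^2 and
    sigma(z_v, z_v) = - G z / C^2, where E = <z_u, z_u> and G = <z_v, z_v>; the
    metric is diagonal, so each contributes - z / C^2 to the trace. *)
Lemma mean_curvature_spherical (C : R) (HC : C <> 0) (Hsph : spherical C J)
    (u v : R) (Hu : J u) :
  mean_curvature rotational u v = scal (- / C ^ 2) (rotational u v).
Proof.
  assert (HEu := first_form_uu_neq u Hu). assert (HGu := first_form_vv_neq u Hu).
  unfold mean_curvature, sigma_uu, sigma_uv, sigma_vv.
  rewrite fE_rotational, fF_rotational, fG_rotational, d_uu_rotational, d_vv_rotational.
  rewrite !(normal_part_spherical C HC Hsph _ _ u v Hu).
  rewrite (spherical_second C Hsph u Hu).
  destruct (frame_onto (normal_part rotational u v (d_v (d_u rotational) u v)) v)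
    as (a & b & c & d & ->).
  unfold rotational; rewrite !frame_scal, !frame_plus, frame_scal.
  assert (HC2 : C ^ 2 <> 0) by apply pow_nonzero, HC.
  assert (HvvG : - alpha ^ 2 * f u * f u + eps * (beta ^ 2 * g u * g u) = - first_form_vv u)
    by (unfold first_form_vv; ring).
  rewrite HvvG; f_equal; field; repeat split; auto.
Qed.

Lemma spherical_implies_parallel (C : R) (HC : C <> 0) (Hsph : spherical C J) :
  parallel_normalized_mean_curvature J rotational.
Proof.
  assert (HC2 : C ^ 2 <> 0) by apply pow_nonzero, HC.
  assert (Hpos : 0 < Rabs C) by now apply Rabs_pos_lt.
  assert (Habs : Rabs C * Rabs C = C ^ 2) by (rewrite <- Rabs_mult, Rabs_pos_eq; nra).
  assert (Hzz : forall u v, J u -> mink (rotational u v) (rotational u v) = C ^ 2).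
  { intros u v Hu; unfold rotational; rewrite mink_frame, <- (Hsph u Hu); ring. }
  split.
  - intros u v [Hu _] H0.
    assert (H := f_equal (fun w => mink w (rotational u v)) H0); simpl in H.
    rewrite (mean_curvature_spherical C HC Hsph u v Hu), mink_zero_l, mink_scal_l,
      Hzz in H by exact Hu.
    replace (- / C ^ 2 * C ^ 2) with (-1) in H by (field; auto). lra.
  - set (k := - / Rabs C).
    set (xi := fun u v => frame (k * f u) 0 (k * g u) 0 v).
    assert (Hxi : forall u v, xi u v = scal k (rotational u v)).
    { intros u v; unfold xi, rotational; rewrite frame_scal; f_equal; ring. }
    exists xi; split; [|split; [|split]].
    + intros u v [Hu _]; split.
      * rewrite Hxi, mink_scal_l, mink_sym, mink_scal_l, (Hzz u v Hu), <- Habs.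
        unfold k; field; lra.
      * exists (Rabs C); split; [exact Hpos|].
        rewrite (mean_curvature_spherical C HC Hsph u v Hu), Hxi.
        unfold rotational; rewrite !frame_scal, <- Habs.
        unfold k; f_equal; field; lra.
    + intros u v [Hu _].
      assert (Htrig1 : forall t, is_derive (fun s => cos (alpha * s)) t
        (- alpha * sin (alpha * t))) by (intro t; auto_derive; [auto|ring]).
      assert (Htrig2 : forall t, is_derive (fun s => sin (alpha * s)) t
        (alpha * cos (alpha * t))) by (intro t; auto_derive; [auto|ring]).
      assert (Hsep : forall (h p q : R -> R) (m n : R), smooth_on J h ->
        (forall t, is_derive p t (m * q t)) -> (forall t, is_derive q t (n * p t)) ->
        forall F : R -> R -> R, (forall x y, F x y = h x * (k * p y)) -> smooth2 F u v).
      { intros h p q m n Hh Hp Hq F HF.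
        replace F with (fun x y => h x * (k * p y))
          by (do 2 (apply functional_extensionality; intro); symmetry; apply HF).
        apply (smooth2_mult_separate J h (fun t => k * p t) (fun t => k * q t) m n); auto.
        - intro t; replace (m * (k * q t)) with (k * (m * q t)) by ring.
          apply (is_derive_scal p); auto.
        - intro t; replace (n * (k * p t)) with (k * (n * p t)) by ring.
          apply (is_derive_scal q); auto. }
      unfold xi, frame, x1, x2, x3, x4; simpl.
      split; [|split; [|split]].
      * apply (Hsep f _ _ _ _ Hf Htrig1 Htrig2); intros; ring.
      * apply (Hsep f _ _ _ _ Hf Htrig2 Htrig1); intros; ring.
      * apply (Hsep g _ _ _ _ Hg HP HQ); intros; ring.
      * apply (Hsep g _ _ _ _ Hg HQ HP); intros; ring.
    + intros u v [Hu _].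
      rewrite Hxi; unfold normal_at.
      rewrite !mink_scal_l, d_u_rotational, d_v_rotational; unfold rotational.
      rewrite !mink_frame; split; [|ring].
      transitivity (k * (f u * Derive f u + eps * (g u * Derive g u))); [ring|].
      rewrite (spherical_orthogonal C Hsph u Hu); ring.
    + intros u v [Hu _] a b.
      assert (HEu := first_form_uu_neq u Hu). assert (HGu := first_form_vv_neq u Hu).
      unfold normal_connection.
      replace (plus (scal a (d_u xi u v)) (scal b (d_v xi u v)))
        with (plus (scal (a * k) (d_u rotational u v)) (scal (b * k) (d_v rotational u v))).
      * apply normal_part_tangent; rewrite fE_rotational, fF_rotational, fG_rotational.
        assert (HEG := Rmult_integral_contrapositive_currified _ _ HEu HGu).
        intro H; apply HEG; rewrite <- H; ring.
      * unfold xi.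
        rewrite (d_u_frame (fun u => k * f u) (fun u => k * g u)),
          (d_v_frame (fun u => k * f u) (fun _ => 0) (fun u => k * g u) (fun _ => 0)),
          d_u_rotational, d_v_rotational, !Derive_scal, !frame_scal, !frame_plus.
        f_equal; ring.
Qed.

(** * Conics as graphs *)

Lemma spherical_regular (C : R) (Hsph : spherical C J) (u : R) (Hu : J u)
    (Hfu : f u <> 0) :
  Derive g u <> 0.
Proof.
  intro Hz. assert (H := spherical_orthogonal C Hsph u Hu).
  rewrite Hz, !Rmult_0_r, Rplus_0_r in H.
  apply Rmult_integral in H; destruct H as [H|H]; [auto|].
  apply (first_form_uu_neq u Hu); unfold first_form_uu; rewrite Hz, H; ring.
Qed.

Lemma spherical_graph (C : R) (Hsph : spherical C J) (I : R -> Prop) (HI : interval I)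
    (HIJ : forall u, I u -> J u /\ f u <> 0) :
  exists e, (e = 1 \/ e = -1) /\ forall u, I u ->
    f u = e * sqrt (C ^ 2 - eps * g u ^ 2).
Proof.
  destruct (constant_sign I HI f) as [e [He Hs]].
  - intros u Hu; apply ex_derive_continuity_pt.
    apply (smooth_on_derive J f Hf u), HIJ, Hu.
  - intros u Hu; apply HIJ, Hu.
  - exists e; split; [exact He|]. intros u Hu.
    rewrite <- (Hsph u (proj1 (HIJ u Hu))).
    replace (f u ^ 2 + eps * g u ^ 2 - eps * g u ^ 2) with (Rsqr (e * f u))
      by (unfold Rsqr; destruct He as [-> | ->]; ring).
    rewrite sqrt_Rsqr by (left; auto).
    destruct He as [-> | ->]; ring.
Qed.

(** If the equation of the conic failed at some point, by continuity it would fail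
    on a whole neighbourhood in [J]; there [f] would be identically zero, so
    f = f' = 0, which the absence of inflection points excludes. *)
Lemma spherical_of_nonzero (Hinf : no_inflection_points J rotational) (C : R)
    (Hsph : forall I : R -> Prop, interval I ->
      (forall u, I u -> J u /\ f u <> 0) -> spherical C I) :
  spherical C J.
Proof.
  assert (Hcont : forall h, (forall u, J u -> ex_derive h u) -> forall u, J u -> h u <> 0 ->
    exists d, 0 < d /\ forall x, Rabs (x - u) < d -> h x <> 0).
  { intros h Hh u Hu Hne.
    assert (Hc := ex_derive_continuity_pt h u (Hh u Hu)).
    destruct (continuous_neq_0 h u) as [d Hd]; auto.
    exists d; split; [apply cond_pos|]; intros x Hx.
    replace x with (u + (x - u)) by ring. apply Hd, Hx. }
  assert (Df : forall u, J u -> ex_derive f u)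
    by (intros u Hu; apply (smooth_on_derive J f Hf u Hu)).
  assert (Hnz : forall u, J u -> f u <> 0 -> f u ^ 2 + eps * g u ^ 2 = C ^ 2).
  { intros u Hu Hne. destruct (Hcont f Df u Hu Hne) as [d [Hd Hdf]].
    apply (Hsph _ (interval_inter_ball J HJ u Hu d Hd)).
    - intros x [Hx Hxd]; auto.
    - split; [exact Hu|]; rewrite Rminus_diag, Rabs_R0; exact Hd. }
  intros u Hu.
  apply Rminus_diag_uniq.
  destruct (Req_dec (f u ^ 2 + eps * g u ^ 2 - C ^ 2) 0) as [|Hne]; [assumption|exfalso].
  destruct (Hcont (fun t => f t ^ 2 + eps * g t ^ 2 - C ^ 2)) with (u := u)
    as [d [Hd Hdh]]; auto.
  { intros t Ht. apply (ex_derive_minus (V := R_NormedModule));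
      [eexists; apply is_derive_radius; auto | apply ex_derive_const]. }
  assert (HI := interval_inter_ball J HJ u Hu d Hd).
  assert (Hu0 : J u /\ Rabs (u - u) < d)
    by (split; [exact Hu|]; rewrite Rminus_diag, Rabs_R0; exact Hd).
  assert (Hz : forall x, J x /\ Rabs (x - u) < d -> f x = 0).
  { intros x [Hx Hxd]. destruct (Req_dec (f x) 0) as [|Hnx]; [assumption|exfalso].
    apply (Hdh x Hxd). apply Rminus_diag_eq, Hnz; assumption. }
  apply (no_inflection_wronskian Hinf u Hu).
  rewrite (Hz u Hu0), (Derive_zero_on_interval _ HI f 0 u Hu0 Hz (Df u Hu)); ring.
Qed.

End RotationalSurface.

(** * The two types of rotational surfaces *)

Theorem theorem8p1
    (J : R -> Prop) (HJ : interval J)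
    (f g : R -> R) (Hf : smooth_on J f) (Hg : smooth_on J g)
    (alpha beta : R) (Halpha : 0 < alpha) (Hbeta : 0 < beta) :
  ((forall u, J u -> Derive f u ^ 2 - Derive g u ^ 2 < 0) ->
   (forall u, J u -> 0 < alpha ^ 2 * f u ^ 2 + beta ^ 2 * g u ^ 2) ->
   no_inflection_points J (surface1 alpha beta f g) ->
   (parallel_normalized_mean_curvature J (surface1 alpha beta f g) <->
    exists C, C <> 0 /\ determined1 J f g C))
  /\
  ((forall u, J u -> alpha ^ 2 * f u ^ 2 - beta ^ 2 * g u ^ 2 < 0) ->
   (forall u, J u -> 0 < Derive f u ^ 2 + Derive g u ^ 2) ->
   no_inflection_points J (surface2 alpha beta f g) ->
   (* the meridian may cross the line x1 = 0, where the graph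
      f = +/- sqrt (C^2 - u^2) over (-C, C) breaks up into arcs *)
   (parallel_normalized_mean_curvature J (surface2 alpha beta f g) <->
    exists C, C <> 0 /\
      forall J' : R -> Prop, interval J' ->
        (forall u, J' u -> J u /\ f u <> 0) -> determined2 J' f g C)
   /\
   ((forall u, J u -> f u <> 0) ->
    (parallel_normalized_mean_curvature J (surface2 alpha beta f g) <->
     exists C, C <> 0 /\ determined2 J f g C))).
Proof.
  set (Sh := fun v => sinh (beta * v)). set (Ch := fun v => cosh (beta * v)).
  assert (HS : forall v, is_derive Sh v (beta * Ch v)).
  { intro v; apply (is_derive_comp sinh (fun v => beta * v) v (cosh (beta * v)) beta).
    - apply is_derive_Reals, derivable_pt_lim_sinh.
    - auto_derive; [auto|ring]. }
  assert (HC : forall v, is_derive Ch v (beta * Sh v)).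
  { intro v; apply (is_derive_comp cosh (fun v => beta * v) v (sinh (beta * v)) beta).
    - apply is_derive_Reals, derivable_pt_lim_cosh.
    - auto_derive; [auto|ring]. }
  assert (Hhyp : forall v, Ch v * Ch v - Sh v * Sh v = 1).
  { intro v. unfold Ch, Sh, cosh, sinh.
    assert (He : exp (beta * v) * exp (- (beta * v)) = 1)
      by (rewrite <- exp_plus, Rplus_opp_r; apply exp_0).
    transitivity (exp (beta * v) * exp (- (beta * v))); [field | exact He]. }
  split.
  - intros Hdu Hdv _.
    replace (surface1 alpha beta f g) with (rotational alpha Sh Ch f g)
      by (do 2 (apply functional_extensionality; intro);
          apply R4_ext;
          unfold rotational, frame, surface1, Sh, Ch, x1, x2, x3, x4; simpl; ring).
    assert (Heps : -1 = 1 \/ -1 = -1) by auto.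
    assert (HPQ : forall v, Sh v * Sh v - Ch v * Ch v = -1)
      by (intro v; specialize (Hhyp v); lra).
    assert (HE : forall u, J u -> 0 < -1 * first_form_uu (-1) f g u)
      by (intros u Hu; specialize (Hdu u Hu); unfold first_form_uu; lra).
    assert (HG : forall u, J u -> 0 < - -1 * first_form_vv (-1) alpha beta f g u)
      by (intros u Hu; specialize (Hdv u Hu); unfold first_form_vv; lra).
    split.
    + intro Hpar.
      destruct (parallel_implies_spherical (-1) alpha beta Sh Ch Heps Halpha Hbeta HS HC HPQ
        f g J HJ Hf Hg HE HG Hpar) as [C [HC0 Hsph]].
      exists C; split; [lra|].
      assert (Hf0 : forall u, J u -> J u /\ f u <> 0).
      { intros u Hu; split; [exact Hu|]; intro H0.
        specialize (Hsph u Hu); rewrite H0 in Hsph. nra. }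
      destruct (spherical_graph (-1) f g J Hf C Hsph J HJ Hf0) as [e [He Hgr]].
      exists e; split; [exact He|]. exists g; split; [exact Hg|].
      intros u Hu; split; [|split; [exact I|]].
      * exact (spherical_regular (-1) f g J HJ Hf Hg HE C Hsph u Hu (proj2 (Hf0 u Hu))).
      * unfold meridian1; rewrite (Hgr u Hu).
        replace (C ^ 2 - -1 * g u ^ 2) with (g u ^ 2 + C ^ 2) by ring. reflexivity.
    + intros [C [HC0 [e [He [phi [_ Hphi]]]]]].
      apply (spherical_implies_parallel (-1) alpha beta Sh Ch Heps HS HC HPQ
        f g J HJ Hf Hg HE HG C HC0).
      intros u Hu; destruct (Hphi u Hu) as [_ [_ Heq]].
      unfold meridian1 in Heq; injection Heq as Hfu Hgu.
      rewrite Hfu, Hgu, Rpow_mult_distr, pow2_sqrt by nra.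
      destruct He as [-> | ->]; ring.
  - intros Hdv Hdu Hinf.
    assert (Hsurf : surface2 alpha beta f g = rotational alpha Ch Sh f g)
      by (do 2 (apply functional_extensionality; intro);
          apply R4_ext;
          unfold rotational, frame, surface2, Sh, Ch, x1, x2, x3, x4; simpl; ring).
    rewrite Hsurf in Hinf |- *; clear Hsurf.
    assert (Heps : 1 = 1 \/ 1 = -1) by auto.
    assert (HE : forall u, J u -> 0 < 1 * first_form_uu 1 f g u)
      by (intros u Hu; specialize (Hdu u Hu); unfold first_form_uu; lra).
    assert (HG : forall u, J u -> 0 < - 1 * first_form_vv 1 alpha beta f g u)
      by (intros u Hu; specialize (Hdv u Hu); unfold first_form_vv; lra).
    assert (Hto : parallel_normalized_mean_curvature J (rotational alpha Ch Sh f g) ->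
      exists C, C <> 0 /\ forall J' : R -> Prop, interval J' ->
        (forall u, J' u -> J u /\ f u <> 0) -> determined2 J' f g C).
    { intro Hpar.
      destruct (parallel_implies_spherical 1 alpha beta Ch Sh Heps Halpha Hbeta HC HS Hhyp
        f g J HJ Hf Hg HE HG Hpar) as [C [HC0 Hsph]].
      exists C; split; [lra|]. intros J' HJ' Hsub.
      destruct (spherical_graph 1 f g J Hf C Hsph J' HJ' Hsub) as [e [He Hgr]].
      exists e; split; [exact He|]. exists g.
      split; [intros u Hu; apply Hg, Hsub, Hu|].
      intros u Hu; destruct (Hsub u Hu) as [Hu' Hfu]; split; [|split].
      * exact (spherical_regular 1 f g J HJ Hf Hg HE C Hsph u Hu' Hfu).
      * specialize (Hsph u Hu').
        assert (0 < f u ^ 2) by (apply pow2_gt_0, Hfu). nra.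
      * unfold meridian2; rewrite (Hgr u Hu), Rmult_1_l; reflexivity. }
    assert (Hfrom : forall C (I : R -> Prop), determined2 I f g C -> spherical 1 f g C I).
    (* - C < phi u < C makes C^2 - (phi u)^2 positive and excludes C < 0 *)
    { intros C I [e [He [phi [_ Hphi]]]] u Hu.
      destruct (Hphi u Hu) as [_ [Hin Heq]].
      unfold meridian2 in Heq; injection Heq as Hfu Hgu.
      rewrite Hfu, Hgu, Rpow_mult_distr, pow2_sqrt by nra.
      destruct He as [-> | ->]; ring. }
    assert (Hpar : forall C, C <> 0 -> spherical 1 f g C J ->
      parallel_normalized_mean_curvature J (rotational alpha Ch Sh f g))
      by exact (spherical_implies_parallel 1 alpha beta Ch Sh Heps HC HS Hhyp
           f g J HJ Hf Hg HE HG).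
    split; [split; [exact Hto|]|].
    + intros [C [HC0 Hdet]]. apply (Hpar C HC0).
      apply (spherical_of_nonzero 1 alpha beta Ch Sh Heps HC HS Hhyp
        f g J HJ Hf Hg HE HG Hinf C).
      intros I HI Hsub; apply Hfrom, Hdet; assumption.
    + intro Hf0; split.
      * intro Hp; destruct (Hto Hp) as [C [HC0 Hdet]].
        exists C; split; [exact HC0|]; apply Hdet; auto.
      * intros [C [HC0 Hdet]]; apply (Hpar C HC0), Hfrom, Hdet.
Qed.
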